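(* There is a constant $c>0$ such that, if $G$ is chosen uniformly at random from the set $\mathcal{G}_{n,n}$ of all $2^{n^2}$ bipartite graphs with fixed labelled partite sets $V_1,V_2$, $|V_1|=|V_2|=n$, then with probability tending to $1$ as $n\to\infty$, $f_{\min}(G)\ge cn/\log n$.
   Context: For a graph $G$ and a positive integer $k$, a $k$-min-difference representation of $G$ is an assignment of a finite set $A_i$ to each vertex $i$ such that for distinct vertices $i,j$: $ij\in E(G)$ if and only if $\min\{|A_i\setminus A_j|,|A_j\setminus A_i|\}\ge k$. $f_{\min}(G)$ denotes the smallest $k$ such that $G$ has a $k$-min-difference representation. *)

(* Defs.v *)
From mathcomp Require Import all_boot all_order all_algebra.
From mathcomp Require Import all_classical all_reals all_analysis.

Set Implicit Arguments.
Unset Strict Implicit.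
Unset Printing Implicit Defensive.

Import Order.TTheory GRing.Theory Num.Theory.
Import numFieldNormedType.Exports.

Record sgraph (V : finType) := SGraph {
  adj : rel V;
  adj_sym : symmetric adj;
  adj_irr : irreflexive adj }.

(* As V is finite, the sets A i can be taken inside one finite ground set. *)
Definition min_diff_rep (V : finType) (G : sgraph V) (k : nat) : Prop :=
  exists (U : finType) (A : V -> {set U}),
    forall i j : V, i != j ->
      adj G i j = (k <= minn #|A i :\: A j| #|A j :\: A i|)%N.

(* All A i have #|V| elements; A i and A j meet exactly when i and j are
   distinct and non-adjacent, so k = #|V| works. *)
Lemma min_diff_rep_exists (V : finType) (G : sgraph V) :
  exists k : nat, (0 < k)%N && `[< min_diff_rep G k >].
Proof.
have [V0|Vpos] := posnP #|V|.
  exists 1%N => /=; apply/asboolP; exists V, (fun=> finset.set0) => i.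
  by have := card0_eq V0 i; rewrite !inE.
exists #|V|; rewrite Vpos /=; apply/asboolP.
pose e i j : option V * {set V} :=
  ((if adj G i j || (i == j) then Some i else None), [set i; j]%SET).
have e_inj i : injective (e i).
  move=> a b [_ /setP E]; have := E a; have := E b; rewrite !inE !eqxx !orbT.
  case: (eqVneq b i) => [->|_] /=; first by move=> _; rewrite orbb => /esym/eqP.
  by move=> /eqP.
pose A i := (e i @: [set: V])%SET.
have cA i : #|A i| = #|V| by rewrite card_imset // cardsT.
have AI i j : i != j -> adj G i j = (A i :&: A j == finset.set0)%SET.
  move=> ij; apply/idP/eqP => [Gij|/setP I0].
    apply/setP => x; rewrite !inE; apply/negP => /andP[/imsetP[a _ ->]].
    move=> /imsetP[b _] [+ /setP E].
    have := E i; have := E j; rewrite !inE !eqxx /= (negPf ij) eq_sym (negPf ij) /=.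
    move=> /eqP <- _; rewrite Gij /=.
    by case: ifP => // _ [] /eqP; rewrite (negPf ij).
  apply: contraT => nG; have := I0 (e i j); rewrite !inE.
  rewrite imset_f ?inE //=.
  suff -> : e i j = e j i by rewrite imset_f ?inE.
  rewrite /e adj_sym eq_sym [j == i]eq_sym (negPf ij).
  by rewrite adj_sym (negPf nG) /= finset.setUC.
exists _, A => i j ij.
have D a b : (#|V| <= #|A a :\: A b|)%N = (A a :&: A b == finset.set0)%SET.
  by rewrite cardsD cA -cards_eq0; have := subset_leq_card (finset.subsetIl (A a) (A b));
     rewrite cA; case: #|_ :&: _|%SET => [|m] h; rewrite ?subn0 ?leqnn // leqNgt ltn_subrL Vpos.
by rewrite leq_min !D finset.setIC andbb AI // finset.setIC.
Qed.

Definition fmin (V : finType) (G : sgraph V) : nat :=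
  ex_minn (min_diff_rep_exists G).

(* The partite sets are the two summands of 'I_n + 'I_n; (a, b) \in E joins
   inl a to inr b. *)
Definition bip_adj (n : nat) (E : {set 'I_n * 'I_n}) : rel ('I_n + 'I_n) :=
  fun u v => match u, v with
             | inl a, inr b | inr b, inl a => (a, b) \in E
             | _, _ => false
             end.

Lemma bip_adj_sym (n : nat) (E : {set 'I_n * 'I_n}) : symmetric (bip_adj E).
Proof. by move=> [a|a] [b|b]. Qed.

Lemma bip_adj_irr (n : nat) (E : {set 'I_n * 'I_n}) : irreflexive (bip_adj E).
Proof. by move=> [a|a]. Qed.

Definition bip_graph (n : nat) (E : {set 'I_n * 'I_n}) : sgraph ('I_n + 'I_n)%type :=
  SGraph (bip_adj_sym E) (bip_adj_irr E).

Lemma card_bip (n : nat) : #|{set 'I_n * 'I_n}| = (2 ^ (n ^ 2))%N.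
Proof. by rewrite -cardsT -powersetT card_powerset cardsT card_prod card_ord mulnn. Qed.

Definition prob_unif (R : realType) (T : finType) (A : {set T}) : R :=
  (#|A|%:R / #|T|%:R)%R.

(* Main.v *)
(** Graphs with [fmin <= K] are counted by encoding them.  Both partite sets are
    independent, so once the sets of one side are sorted by cardinality,
    [a 0, a 1, ...], each difference [a i :\: a i.+1] has fewer than [K] elements.
    Let [D] be the union of these differences for one side; [#|D| <= n * K].
    - Inside [D], each side is determined by the pairs (element, index) at which
      membership changes; at most [K] elements leave at each step and the number
      of entries exceeds that of exits by at most [#|D|], so there are [O(n * K)]
      such pairs on either side.
    - Outside [D] the sets [a i] increase with [i], so for fixed [j] the numbers
      [#|(a i :\: b j) :\: D|] and [#|(b j :\: a i) :\: D|] are monotone in [i].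
      They matter only up to [K], hence are given by [K] thresholds for each [j].
    Thus [O(n * K)] numbers of polynomial size determine the graph, which leaves
    [(n.+1) ^ O(n * K)] graphs; this is [o(2 ^ n ^ 2)] for [K <= c n / ln n]. *)

Require Import Defs.
From mathcomp Require Import all_boot all_order all_algebra.
From mathcomp Require Import all_classical all_reals all_analysis.
From mathcomp Require Import zify lra.

Set Implicit Arguments.
Unset Strict Implicit.
Unset Printing Implicit Defensive.

Import Order.TTheory GRing.Theory Num.Theory.
Import numFieldNormedType.Exports.

(** * Sorted families and restriction to a set of bounded size *)

Lemma card_setD_sym (U : finType) (S T : {set U}) :
  (#|S :\: T| + #|T| = #|T :\: S| + #|S|)%N.
Proof.
by have := cardsID T S; have := cardsID S T; rewrite [in X in X -> _]finset.setIC; lia.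
Qed.

(** In the order of increasing cardinality, earlier minus later is the smaller of the two
    differences, so the bound on the minimum falls on it. [p] gives the position of a vertex in that
    order. *)
Lemma sort_family (n k : nat) (U : finType) (A : 'I_n -> {set U}) :
    (forall i j, i != j -> minn #|A i :\: A j| #|A j :\: A i| <= k)%N ->
  exists (a : nat -> {set U}) (p : 'I_n -> 'I_n),
    (forall i, i.+1 < n -> #|a i :\: a i.+1| <= k)%N /\
    (forall i, a (p i) = A i).
Proof.
move=> hA; pose r := relpre (fun i => #|A i|) leq.
pose s := sort r (enum 'I_n).
have ss : size s = n by rewrite size_sort size_enum_ord.
have su : uniq s by rewrite sort_uniq enum_uniq.
have ms i : i \in s by rewrite mem_sort mem_enum.
have sp i : (index i s < n)%N by rewrite -[X in (_ < X)%N]ss index_mem.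
exists (fun i => nth finset.set0 (map A s) i), (fun i => Ordinal (sp i)).
split=> [i lt_in | i] /=; last by rewrite (nth_map i) ?nth_index // ss.
have lt_in' := ltnW lt_in.
set x0 := Ordinal lt_in.
rewrite !(nth_map x0) ?ss //.
have le_c : (#|A (nth x0 s i)| <= #|A (nth x0 s i.+1)|)%N.
  have := @sorted_leq_nth _ r _ _ x0 s _ i i.+1.
  apply; rewrite ?inE ?ss //.
  - by move=> y x z; apply: leq_trans.
  - by move=> x; apply: leqnn.
  - by apply: sort_sorted => x y; apply: leq_total.
have := hA (nth x0 s i) (nth x0 s i.+1).
rewrite nth_uniq ?ss // ltn_eqF // => /(_ isT).
have := card_setD_sym (A (nth x0 s i)) (A (nth x0 s i.+1)); lia.
Qed.

(** The ground set [U] of a representation has unbounded size; numbering the elements of [D] moves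
    the traces to a type fixed by [N], so that codes can be counted. The successor makes [inord]
    available. *)
Lemma set_trace (U : finType) (D : {set U}) (N : nat) : (#|D| <= N)%N ->
  exists F : {set U} -> {set 'I_N.+1},
    forall S T, #|F S :\: F T| = #|(S :\: T) :&: D|.
Proof.
move=> leDN; pose g x : 'I_N.+1 := inord (index x (enum D)).
have lt_ind x : x \in D -> (index x (enum D) < N.+1)%N.
  by move=> xD; rewrite ltnS (leq_trans _ leDN) // cardE ltnW // index_mem mem_enum.
have g_inj : {in D &, injective g}.
  move=> x y xD yD /(congr1 val); rewrite /= !inordK ?lt_ind // => e.
  by rewrite -(nth_index x (_ : x \in enum D)) ?mem_enum // e nth_index ?mem_enum.
exists (fun S => [set g x | x in S :&: D])%SET => S T.
rewrite -(card_in_imset (f := g)); last first.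
  by move=> x y /setIP[_ xD] /setIP[_ yD]; apply: g_inj.
apply: eq_card => y; rewrite inE; apply/andP/imsetP.
  move=> [nyT /imsetP[x /setIP[xS xD] ey]]; exists x => //.
  rewrite !inE xS xD !andbT; apply: contra nyT => xT.
  by rewrite ey imset_f // inE xT.
move=> [x]; rewrite !inE => /andP[/andP[nxT xS] xD] ->; split.
  apply/imsetP => -[z /setIP[zT zD]] /g_inj e.
  by rewrite (e xD zD) zT in nxT.
by rewrite imset_f // inE xS.
Qed.

(** * Encodings of set sequences, monotone functions and small sets *)

(* [(x, j) \in c] means that membership of [x] is switched at time [j]. *)
Definition parity_dec (T : finType) (n : nat) (c : {set T * 'I_n}) (i : nat)
    : {set T} :=
  [set x | \big[addb/false]_(j < n | (j <= i)%N) ((x, j) \in c)].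

Lemma parity_code (T : finType) (n k : nat) (a : nat -> {set T}) :
    (forall i, i.+1 < n -> #|a i :\: a i.+1| <= k)%N ->
  exists2 c : {set T * 'I_n}, (#|c| <= #|T| + 2 * (n * k))%N &
    forall i : 'I_n, parity_dec c i = a i.
Proof.
move=> ha.
(* Starting from the empty set, all of [a 0] enters at time 0. *)
pose prev i := if i is j.+1 then a j else finset.set0.
pose delta i := ((a i :\: prev i) :|: (prev i :\: a i))%SET.
have in_delta x i : (x \in delta i) = (x \in a i) (+) (x \in prev i).
  by rewrite !inE; do 2 case: (x \in _).
have card_delta i : (#|delta i| + #|prev i| <= #|a i| + 2 * #|prev i :\: a i|)%N.
  have := card_setD_sym (a i) (prev i); rewrite /delta cardsU; lia.
have prev_k i : (i < n -> #|prev i :\: a i| <= k)%N.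
  by case: i => [|i] /= lt_in; [rewrite finset.set0D cards0 | apply: ha].
(* Switches at one time number the growth in cardinality plus twice the exits; the growth telescopes
   to [#|a m|]. *)
have sum_delta m : (m < n -> \sum_(i < m.+1) #|delta i| <= #|a m| + 2 * (m.+1 * k))%N.
  elim: m => [|m IH] lt_mn.
    rewrite big_ord1 [X in delta X]/=.
    by have := card_delta 0%N; have := prev_k 0%N lt_mn; lia.
  rewrite big_ord_recr /=; have := IH (ltnW lt_mn).
  have := card_delta m.+1; have := prev_k _ lt_mn; rewrite /=; lia.
exists [set p : T * 'I_n | p.1 \in delta p.2]%SET; last first.
  move=> i; apply/setP => x; rewrite inE.
  under eq_bigr do rewrite inE /=.
  transitivity (\big[addb/false]_(j < i.+1) (x \in delta j)).
    by rewrite (big_ord_widen n (fun j => x \in delta j)).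
  elim: {i}(i : nat) => [|i IH]; first by rewrite big_ord1 in_delta inE addbF.
  by rewrite big_ord_recr /= IH in_delta /= addbCA addbb addbF.
have -> : #|[set p : T * 'I_n | p.1 \in delta p.2]%SET| = (\sum_(i < n) #|delta i|)%N.
  rewrite -sum1dep_card big_mkcond /=.
  rewrite -(pair_bigA _ (fun x (i : 'I_n) => if x \in delta i then 1 else 0)%N) /=.
  rewrite exchange_big; apply: eq_bigr => i _ /=.
  by rewrite -big_mkcond sum1_card.
case: n ha {prev_k} sum_delta => [|n] ha sum_delta; first by rewrite big_ord0.
by apply: leq_trans (sum_delta n (ltnSn n)) _; rewrite leq_add2r max_card.
Qed.

(* [c v] is the first time at which the encoded nondecreasing function exceeds [v]. *)
Definition threshold_dec (n K : nat) (c : {ffun 'I_K -> 'I_n.+1}) (i : nat) : nat :=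
  (\sum_(v < K) (c v <= i))%N.

Lemma threshold_code (n K : nat) (f : 'I_n -> nat) :
    (forall i j : 'I_n, i <= j -> f i <= f j)%N ->
  exists c : {ffun 'I_K -> 'I_n.+1}, forall i : 'I_n, threshold_dec c i = minn K (f i).
Proof.
move=> f_mono.
(* By monotonicity this set is an initial segment, so its cardinality is the first index where [f]
   exceeds [v], or [n] if there is none. *)
pose c0 v := #|[set i : 'I_n | f i <= v]%SET|.
have c0P v : (c0 v < n.+1)%N by rewrite ltnS -[X in (_ <= X)%N]card_ord max_card.
have c0E (v : nat) (i : 'I_n) : (c0 v <= i)%N = (v < f i)%N.
  have card_lt m : (m <= n)%N -> #|[set j : 'I_n | j < m]%SET| = m.
    move=> le_mn; rewrite -sum1dep_card -(big_ord_widen n (fun=> 1%N)) //.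
    by rewrite sum1_card card_ord.
  apply/idP/idP => [|lt_vf].
    apply: contraLR; rewrite -leqNgt -ltnNge => le_fv.
    rewrite -[X in (X <= _)%N](card_lt _ (ltn_ord i)); apply: fintype.subset_leq_card.
    by apply/fintype.subsetP => j; rewrite !inE ltnS => /f_mono /leq_trans; apply.
  rewrite -[X in (_ <= X)%N](card_lt _ (ltnW (ltn_ord i))); apply: fintype.subset_leq_card.
  apply/fintype.subsetP => j; rewrite !inE => le_fj; rewrite ltnNge; apply: contraL lt_vf.
  by move=> /f_mono le_ij; rewrite -leqNgt (leq_trans le_ij).
exists [ffun v : 'I_K => Ordinal (c0P v)] => i; rewrite /threshold_dec.
under eq_bigr do rewrite ffunE /= c0E.
elim: K => [|K IH]; first by rewrite big_ord0 min0n.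
by rewrite big_ord_recr /= IH; lia.
Qed.

(** A list of length [L] padded with [None]: there are only [(#|T| + 1) ^ L] of these, against
    [2 ^ #|T|] arbitrary subsets. *)
Lemma small_set_code (T : finType) (L : nat) (S : {set T}) : (#|S| <= L)%N ->
  exists c : {ffun 'I_L -> option T}, S = [set x | Some x \in codom c]%SET.
Proof.
move=> leSL; exists [ffun l : 'I_L => onth (enum S) l].
apply/setP => x; rewrite inE; apply/idP/codomP => [xS | [l]].
  have /onthP[l el] : x \in enum S by rewrite mem_enum.
  have lt_l : (l < L)%N.
    by rewrite (leq_trans _ leSL) // cardE -onthTE el.
  by exists (Ordinal lt_l); rewrite ffunE.
by rewrite ffunE => el; rewrite -mem_enum; apply/onthP; exists l.
Qed.

(** * The elements that ever leave a sequence of sets *)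

Lemma descents_card (U : finType) (n k : nat) (a : nat -> {set U}) :
    (forall i, i.+1 < n -> #|a i :\: a i.+1| <= k)%N ->
  (#|\bigcup_(i < n.-1) (a i :\: a i.+1)| <= n * k)%N.
Proof.
move=> ha; apply: (@leq_trans (\sum_(i < n.-1) k)).
  apply: (big_ind2 (fun (S : {set U}) m => #|S| <= m)%N) => [|S s T t hS hT|i _].
  - by rewrite cards0.
  - by rewrite (leq_trans (leq_card_setU S T).1) // leq_add.
  - by apply: ha; case: n i => [|n] [].
by rewrite sum_nat_const card_ord leq_mul2r leq_pred orbT.
Qed.

Lemma descents_mono (U : finType) (n : nat) (a : nat -> {set U}) (x : U) (i j : nat) :
    x \notin (\bigcup_(i < n.-1) (a i :\: a i.+1))%SET ->
  (i <= j < n)%N -> x \in a i -> x \in a j.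
Proof.
move=> nxD /andP[]; elim: j => [|j IH]; first by rewrite leqn0 => /eqP ->.
rewrite leq_eqVlt => /predU1P[-> //|le_ij] lt_jn /(IH le_ij (ltnW lt_jn)) xj.
have lt_j : (j < n.-1)%N by case: n lt_jn {nxD IH}.
apply: contraNT nxD => nx; apply/finset.bigcupP; exists (Ordinal lt_j) => //.
by rewrite inE nx.
Qed.

(** * The code of a graph and its decoding *)

Definition changes (n K : nat) :=
  {ffun 'I_(3 * (n * K)).+1 -> option ('I_(n * K).+1 * 'I_n)}.
Definition thresholds (n K : nat) := {ffun 'I_n -> {ffun 'I_K -> 'I_n.+1}}.
Definition ranks (n : nat) := {ffun 'I_n -> 'I_n}.
Definition code (n K : nat) :=
  ('I_K.+1 * (ranks n * ranks n) * (changes n K * changes n K)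
     * (thresholds n K * thresholds n K))%type.

Definition trace_of (n K : nat) (c : changes n K) (i : nat) : {set 'I_(n * K).+1} :=
  parity_dec [set x | Some x \in codom c]%SET i.

(* [#|b j :\: a i|] is nonincreasing in [i] outside [D], hence the [rev_ord]. *)
Definition decode (n K : nat) (x : code n K) : {set 'I_n * 'I_n} :=
  let: (k, (p, q), (c, d), (f, g)) := x in
  [set e | let i := p e.1 in let j := q e.2 in
     let S := trace_of c i in let T := trace_of d j in
     k <= minn (#|S :\: T| + threshold_dec (f j) i)
               (#|T :\: S| + threshold_dec (g j) (rev_ord i))]%SET.

Lemma trace_code (n K : nat) (a : nat -> {set 'I_(n * K).+1}) :
    (forall i, i.+1 < n -> #|a i :\: a i.+1| <= K)%N ->
  exists c : changes n K, forall i : 'I_n, trace_of c i = a i.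
Proof.
move=> /parity_code[C leC decC].
have [c cE] : exists c : changes n K, C = [set x | Some x \in codom c]%SET.
  (* The points number [n * K + 1] and the exits cost [2 * (n * K)], whence the length
     [3 * (n * K) + 1] in [changes]. *)
  by apply: small_set_code; apply: leq_trans leC _; rewrite card_ord; lia.
by exists c => i; rewrite /trace_of -cE.
Qed.

Lemma thresholds_code (n K : nat) (f : 'I_n -> 'I_n -> nat) :
    (forall j i i' : 'I_n, i <= i' -> f j i <= f j i')%N ->
  exists c : thresholds n K, forall j i : 'I_n, threshold_dec (c j) i = minn K (f j i).
Proof.
move=> f_mono.
have [c cE] := choice (fun j => threshold_code K (f_mono j)).
by exists (finfun c) => j i; rewrite ffunE.
Qed.

Lemma rep_decode (n K k : nat) (E : {set 'I_n * 'I_n}) : (k <= K)%N ->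
  min_diff_rep (bip_graph E) k -> exists x : code n K, decode x = E.
Proof.
move=> le_kK [U [A hA]].
have lt_A i j : i != j -> ~~ adj (bip_graph E) i j ->
    (minn #|A i :\: A j| #|A j :\: A i| <= K)%N.
  by move=> ij; rewrite hA // -ltnNge => /ltnW /leq_trans; apply.
have [a [p [a_desc apE]]] :
  exists (a : nat -> {set U}) (p : 'I_n -> 'I_n),
    (forall i, i.+1 < n -> #|a i :\: a i.+1| <= K)%N /\
    (forall i, a (p i) = A (inl i)).
  by apply: sort_family => i j ij; apply: lt_A.
have [b [q [b_desc bqE]]] :
  exists (b : nat -> {set U}) (q : 'I_n -> 'I_n),
    (forall i, i.+1 < n -> #|b i :\: b i.+1| <= K)%N /\
    (forall i, b (q i) = A (inr i)).
  by apply: sort_family => i j ij; apply: lt_A.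
(* Descents of [a] alone suffice: the thresholds fix [j] and use monotonicity in [i] only. The
   traces of [b] on [D] still lose at most [K] elements per step. *)
pose D := (\bigcup_(i < n.-1) (a i :\: a i.+1))%SET.
have [F FE] := set_trace (descents_card a_desc : #|D| <= n * K)%N.
have F_desc (s : nat -> {set U}) :
    (forall i, i.+1 < n -> #|s i :\: s i.+1| <= K)%N ->
    (forall i, i.+1 < n -> #|F (s i) :\: F (s i.+1)| <= K)%N.
  move=> hs i /hs; apply: leq_trans.
  by rewrite FE fintype.subset_leq_card // finset.subsetIl.
have [c cE] := trace_code (F_desc a a_desc).
have [d dE] := trace_code (F_desc b b_desc).
have aD_mono (i i' : 'I_n) : (i <= i')%N -> (a i :\: D \subset a i' :\: D)%SET.
  move=> le_ii'; apply/fintype.subsetP => x; rewrite !inE => /andP[nxD xi].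
  by rewrite nxD (descents_mono nxD _ xi) // le_ii' /=.
have [f fE] : exists f : thresholds n K, forall j i : 'I_n,
    threshold_dec (f j) i = minn K #|(a i :\: b j) :\: D|.
  apply: thresholds_code => j i i' /aD_mono/fintype.subsetP le_ii'.
  apply/fintype.subset_leq_card/fintype.subsetP => x.
  by have := le_ii' x; rewrite !inE; do 4 case: (x \in _) => //=; apply.
have [g gE] : exists g : thresholds n K, forall j i : 'I_n,
    threshold_dec (g j) i = minn K #|(b j :\: a (rev_ord i)) :\: D|.
  apply: (@thresholds_code n K (fun j i => #|(b j :\: a (rev_ord i)) :\: D|)) => j i i' le_ii'.
  have /aD_mono/fintype.subsetP le_rev : (rev_ord i' <= rev_ord i)%N.
    by rewrite /= leq_sub2l.
  apply/fintype.subset_leq_card/fintype.subsetP => x.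
  have := le_rev x; rewrite !inE; do 4 case: (x \in _) => //=.
  all: try by apply.
have gE' (j i : 'I_n) :
    threshold_dec (g j) (n - i.+1) = minn K #|(b j :\: a i) :\: D|.
  by rewrite -[i in RHS]rev_ordK -gE.
have lt_k : (k < K.+1)%N by [].
exists (Ordinal lt_k, (finfun p, finfun q), (c, d), (f, g)).
apply/setP => -[i j]; rewrite inE /= !ffunE cE dE fE gE' !FE /=.
have -> : ((i, j) \in E) = adj (bip_graph E) (inl i) (inr j) by [].
rewrite hA // -apE -bqE !leq_min.
(* Each difference splits into its parts inside and outside [D]; capping the outer part at [K] does
   not affect comparison with [k], since [k <= K]. *)
rewrite -(cardsID D (a (p i) :\: b (q j))) -(cardsID D (b (q j) :\: a (p i))).
lia.
Qed.

(** * Counting codes *)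

Lemma card_code (n K : nat) : (0 < K <= n)%N -> (#|{: code n K}| <= n.+1 ^ (29 * (n * K)))%N.
Proof.
move=> /andP[K_gt0 le_Kn].
rewrite !card_prod !card_ffun !card_option !card_prod !card_ord.
have le_n : (n ^ n * n ^ n <= n.+1 ^ (2 * (n * K)))%N.
  rewrite -expnD (@leq_trans (n.+1 ^ (n + n))) ?leq_exp2r ?leq_pexp2l //; nia.
have le_c : (((n * K).+1 * n).+1 ^ (3 * (n * K)).+1 <= n.+1 ^ (3 * (3 * (n * K)).+1))%N.
  by rewrite expnM leq_exp2r //; nia.
have le_t : ((n.+1 ^ K) ^ n = n.+1 ^ (n * K))%N by rewrite -expnM mulnC.
rewrite le_t.
apply: (@leq_trans (n.+1 ^ 1 * n.+1 ^ (2 * (n * K)) *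
   (n.+1 ^ (3 * (3 * (n * K)).+1) * n.+1 ^ (3 * (3 * (n * K)).+1)) *
   (n.+1 ^ (n * K) * n.+1 ^ (n * K)))%N).
  by rewrite !leq_mul.
(* The exponents add up to [22 * (n * K) + 7], at most [29 * (n * K)] because [n * K] is
   positive. *)
rewrite -!expnD leq_pexp2l //; nia.
Qed.

Lemma card_fmin_le (n K : nat) : (K <= n)%N ->
  (#|[set E : {set 'I_n * 'I_n} | (fmin (bip_graph E) <= K)%N]%SET|
    <= n.+1 ^ (29 * (n * K)))%N.
Proof.
move=> le_Kn.
have fminP (E : {set 'I_n * 'I_n}) :
    (0 < fmin (bip_graph E))%N /\ min_diff_rep (bip_graph E) (fmin (bip_graph E)).
  by rewrite /fmin; case: ex_minnP => m /andP[m_gt0 /asboolP].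
have [K0|K_gt0] := posnP K.
  rewrite (_ : [set E | _]%SET = finset.set0) ?cards0 //.
  apply/setP => E; rewrite !inE K0 leqn0; apply/negbTE.
  by rewrite -lt0n; have [] := fminP E.
apply: (leq_trans _ (card_code (n := n) (K := K) _)); last by rewrite K_gt0.
apply: leq_trans (leq_imset_card (@decode n K) _).
apply/fintype.subset_leq_card/fintype.subsetP => E; rewrite inE => le_fK.
have [x <-] := rep_decode le_fK (fminP E).2.
exact: imset_f.
Qed.

(** * Asymptotics *)

Local Open Scope classical_set_scope.
Local Open Scope ring_scope.

(** As [n + 1 <= n ^ 2], the logarithm of the count is at most [58 * n * K * ln n]. With
    [116 = 2 * 58] this is at most [n ^ 2 * ln 2 / 2], and [n ^ 2 / 2 <= n ^ 2 - n] for [n >= 2]. *)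
Lemma card_fmin_small (R : realType) (n K : nat) : (1 < n)%N -> (K <= n)%N ->
    K%:R * ln (n%:R : R) <= ln 2 / 116 * n%:R ->
  #|[set E : {set 'I_n * 'I_n} | (fmin (bip_graph E) <= K)%N]%SET|%:R
    <= 2 ^- n * (2 ^ (n ^ 2))%:R :> R.
Proof.
move=> n_gt1 le_Kn le_K.
have n_gt0 : 0 < n%:R :> R by rewrite ltr0n ltnW.
have ln2_gt0 : 0 < ln 2 :> R by rewrite ln_gt0 // ltr1n.
apply: (@le_trans _ _ ((n ^ 2) ^ (29 * (n * K)))%:R).
  rewrite ler_nat (leq_trans (card_fmin_le le_Kn)) //.
  suff : (n.+1 <= n ^ 2)%N by case: (29 * (n * K))%N => // m; rewrite leq_exp2r.
  by rewrite -mulnn; nia.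
rewrite -[leLHS]lnK ?posrE ?ltr0n ?expn_gt0 ?(ltnW n_gt1) //.
rewrite -[leRHS]lnK ?posrE ?mulr_gt0 ?invr_gt0 ?exprn_gt0 ?ltr0n ?expn_gt0 //.
rewrite ler_expR lnM ?posrE ?invr_gt0 ?exprn_gt0 ?ltr0n ?expn_gt0 //.
rewrite lnV ?posrE ?exprn_gt0 // !natrX !lnXn ?exprn_gt0 //.
have n_ge2 : 2 <= n%:R :> R by rewrite ler_nat.
rewrite -mulrnA -[leLHS]mulr_natr -[X in - X + _]mulr_natr -[X in _ + X]mulr_natr.
rewrite natrX !natrM; move: n_ge2 le_K ln2_gt0 n_gt0.
move: (n%:R : R) (ln n%:R : R) (ln 2 : R) (K%:R : R) => N L l k N2 kL l0 N0.
have := ler_wpM2l (ltW N0) kL; have := ler_wpM2l (ltW (mulr_gt0 l0 N0)) N2; lra.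
Qed.

Theorem theorem2 (R : realType) :
  exists c : R, 0 < c /\
    (fun n : nat =>
       prob_unif R [set E : {set 'I_n * 'I_n} |
         (c * n%:R / ln (n%:R : R) <= (fmin (bip_graph E))%:R)%R]%SET)
      @ \oo --> (1 : R).
Proof.
have ln2_gt0 : 0 < ln 2 :> R by rewrite ln_gt0 // ltr1n.
exists (ln 2 / 116); split; first by rewrite divr_gt0.
set c := ln 2 / 116.
have c_gt0 : 0 < c by rewrite divr_gt0.
(* The exceptional graphs have probability at most [2 ^- n]. *)
apply: (@squeeze_cvgr _ _ _ _ (fun n => 1 - 2 ^- n) (cst 1)); last 2 first.
- rewrite -[X in _ --> X]subr0; apply: cvgB; first exact: cvg_cst.
  under eq_fun do rewrite -exprVn.
  by apply: cvg_expr; rewrite ger0_norm ?invf_lt1 ?invr_ge0 // ltr1n.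
- exact: cvg_cst.
near=> n.
have n_gt1 : (1 < n)%N by near: n; exact: nbhs_infty_gt.
have card_gt0 : 0 < #|{: {set 'I_n * 'I_n}}|%:R :> R.
  by rewrite card_bip ltr0n expn_gt0.
rewrite /prob_unif ler_pdivlMr // ler_pdivrMr //; apply/andP; split; last first.
  by rewrite mul1r ler_nat max_card.
set good := finset.finset _.
have n_gt0 : 0 < n%:R :> R by rewrite ltr0n ltnW.
have le_ln2n : ln 2 <= ln n%:R :> R.
  by rewrite ler_ln ?posrE // ler_nat.
have lnn_gt0 : 0 < ln n%:R :> R := lt_le_trans ln2_gt0 le_ln2n.
(* An integer below [c * n / ln n] is at most its truncation, so every bad graph has [fmin <= K]. *)
pose K := Num.truncn (c * n%:R / ln n%:R).
have x_ge0 : 0 <= c * n%:R / ln n%:R by rewrite divr_ge0 ?mulr_ge0 // ltW.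
have le_K : K%:R <= c * n%:R / ln n%:R by rewrite truncn_le.
have le_Kn : (K <= n)%N.
  rewrite -(ler_nat R) (le_trans le_K) // ler_pdivrMr // mulrC ler_wpM2l ?ltW //.
  by apply: lt_le_trans le_ln2n; rewrite /c; lra.
rewrite ler_pdivlMr // in le_K.
have bad_small := card_fmin_small n_gt1 le_Kn le_K.
rewrite -card_bip in bad_small.
have le_bad : #|~: good|%:R <= 2 ^- n * #|{: {set 'I_n * 'I_n}}|%:R :> R.
  apply: le_trans bad_small; rewrite ler_nat.
  apply/fintype.subset_leq_card/fintype.subsetP => E; rewrite !inE -ltNge => lt_f.
  by rewrite -ltnS -(ltr_nat R) (lt_trans lt_f) // /K truncnS_gt.
by have := le_bad; rewrite -(cardsC good) natrD; lra.
Unshelve. all: by end_near.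
Qed.
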